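(* Let $C\subseteq\mathbb{F}_2^n$ be a binary linear $[n,k,d]$ code with $\mathbf{1}_n\in C$, whose dual $C^\perp$ has minimum distance $d^\perp$, and let $t$ be a positive integer such that $$d^\perp-t=\#\{u \mid C_u\neq\emptyset,\ 0<u\le n-t\}.$$ Let $w\ge 0$ be an integer. (1) Suppose $(d^\perp,t)=(4,2)$. If $$\sum_{i=0}^{w}(-1)^{w-i}\binom{d-3}{w-i}\binom{n-2d}{2i+1}=0,$$ then $D^\perp_{2w+4}$ is a $3$-design. (2) Suppose $(d^\perp,t)=(4,1)$ or $(6,3)$. If $$\left(\sum_{i=0}^{w}(-1)^{w-i}\binom{d-(t+1)}{w-i}\binom{n-2d}{2i}\right)+(-1)^{w+1}\binom{n/2-(t+1)}{w}=0,$$ then $D^\perp_{2w+t+1}$ is a $(t+1)$-design.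
   Context: $\mathbf{1}_n$ is the all-ones vector; $C^\perp$ is the dual code with respect to the standard inner product, with minimum nonzero weight $d^\perp$; $C_u=\{c\in C:\mathrm{wt}(c)=u\}$ (Hamming weight). A $t$-design on point set $X$ is a collection of blocks ($k$-subsets of $X$) such that every $t$-subset of $X$ lies in the same number $\lambda$ of blocks. $D^\perp_w$ denotes the support design of $C^\perp$ for weight $w$: point set $\{1,\dots,n\}$, blocks the supports $\{i: c_i\ne 0\}$ of the codewords $c\in C^\perp$ of weight $w$. *)

(* Defs.v *)
From HB Require Import structures.
From mathcomp Require Import all_boot all_order all_algebra.
Set Implicit Arguments. Unset Strict Implicit. Unset Printing Implicit Defensive.
Import GRing.Theory.
Local Open Scope ring_scope.

Notation bvec n := 'rV['F_2]_n.

Definition supp n (c : bvec n) : {set 'I_n} := [set i | c 0 i != 0].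
Definition wt n (c : bvec n) : nat := #|supp c|.

Definition dotb n (x y : bvec n) : 'F_2 := \sum_(i < n) x 0 i * y 0 i.

Definition dual_code n (C : {vspace bvec n}) : {set bvec n} :=
  [set y : bvec n | [forall c : bvec n, (c \in C) ==> (dotb c y == 0)]].

Definition is_min_dist n (S : {set bvec n}) (d : nat) : Prop :=
  (exists2 c, c \in S & (c != 0) && (wt c == d)) /\
  (forall c, c \in S -> c != 0 -> (d <= wt c)%N).

Definition support_blocks n (S : {set bvec n}) (w : nat) : {set {set 'I_n}} :=
  [set supp c | c in [set c in S | wt c == w]].

(* B is a t-design on the point set 'I_n (with block size implicit in B) *)
Definition is_design n (t : nat) (B : {set {set 'I_n}}) : Prop :=
  exists lam : nat, forall T : {set 'I_n}, #|T| = t ->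
    #|[set b in B | T \subset b]| = lam.

Definition nb_weights n (C : {vspace bvec n}) (t : nat) : nat :=
  #|[set u : 'I_n.+1 | (0 < u <= n - t)%N &&
       [exists c : bvec n, (c \in C) && (wt c == u)]]|.

(* Main.v *)
(* For disjoint pairs (p_j, q_j), let alt c = prod_j (c_{p_j} - c_{q_j}), with
   k factors.  Its Fourier transform over the cube is clean:
     |C| sum_{y in C^perp} alt(y) z^{wt y}
       = (-2z)^k sum_{c in C} alt(c) (1-z)^{wt c-k} (1+z)^{n-wt c-k},
   so alt-sums over the words of weight W of C^perp are governed by the sums
   f_u of alt over the words of weight u of C.  The dual distance annihilates
   sum_u f_u Q(u) for polynomials Q with deg Q + k < d^perp; since C has few
   weights, f = 0 when k <= t (an Assmus-Mattson argument).  When k = t+1,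
   complementation gives f_{n-u} = (-1)^k f_u, and f is supported on d, n-d and
   possibly n/2, with sum_u f_u = 0 if n/2 occurs; up to the factor 2 f_d, the
   coefficient of the right-hand side in weight W is then the expression assumed
   to vanish.  Finally, vanishing of all alt-sums with 1 <= k <= r forces the
   supports of the words of weight W to form an r-design. *)
Require Import Defs.
From HB Require Import structures.
From mathcomp Require Import all_boot all_order all_algebra.
From mathcomp Require Import zify ring.
Set Implicit Arguments. Unset Strict Implicit. Unset Printing Implicit Defensive.
Import GRing.Theory Num.Theory.
Local Open Scope ring_scope.

(** * Integer-valued bits and signs on the binary field *)

Definition bit (a : 'F_2) : int := (a != 0)%:R.
Definition sgn (a : 'F_2) : int := 1 - 2 * bit a.

Lemma F2_case (a : 'F_2) : a = 0 \/ a = 1.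
Proof. by case: a => [[|[|m]] Hm] //; [left|right]; apply/val_inj. Qed.

Lemma bit0 : bit 0 = 0. Proof. by []. Qed.
Lemma bit1 : bit 1 = 1. Proof. by []. Qed.

Lemma bitK a : bit a * bit a = bit a.
Proof. by case: (F2_case a) => ->. Qed.

Lemma bitC a : bit (a + 1) = 1 - bit a.
Proof. by case: (F2_case a) => ->. Qed.

Lemma sgnD a b : sgn (a + b) = sgn a * sgn b.
Proof. by case: (F2_case a) => ->; case: (F2_case b) => ->. Qed.

Lemma sgn_sum (I : finType) (F : I -> 'F_2) :
  sgn (\sum_i F i) = \prod_i sgn (F i).
Proof. exact: (big_morph sgn sgnD). Qed.

(** * Alternating products and monomials on words *)

Section Words.
Variable n : nat.
Implicit Types (c y : bvec n) (ps : seq ('I_n * 'I_n)) (A : seq 'I_n).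

(** The condition [uniq (pts ps)] encodes that the pairs are disjoint and that each consists of two
    distinct points. *)
Definition pts ps : seq 'I_n := flatten [seq [:: e.1; e.2] | e <- ps].
Definition alt ps c : int := \prod_(e <- ps) (bit (c 0 e.1) - bit (c 0 e.2)).
Definition mono A c : int := \prod_(a <- A) bit (c 0 a).

Lemma altS p q ps c :
  alt ((p, q) :: ps) c = (bit (c 0 p) - bit (c 0 q)) * alt ps c.
Proof. by rewrite /alt big_cons. Qed.

Lemma sum_bit c : \sum_i bit (c 0 i) = (wt c)%:R.
Proof.
rewrite /wt /supp /bit -sum1_card natr_sum [RHS]big_mkcond /=.
by apply: eq_bigr => i _; rewrite inE; case: eqP.
Qed.

(** Bits are idempotent, so [(bp - bq) * (bp + bq) = bp - bq]: where [alt] is nonzero, each pair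
    contains exactly one point of the support. *)
Lemma alt_sum_pts ps c :
  alt ps c * (\sum_(i <- pts ps) bit (c 0 i)) = alt ps c * (size ps)%:R.
Proof.
elim: ps => [|[p q] ps IH]; first by rewrite /= big_nil.
rewrite altS /= !big_cons -natr1.
have Hp := bitK (c 0 p); have Hq := bitK (c 0 q).
set bp := bit _ in Hp *; set bq := bit (c 0 q) in Hq *.
have -> : (bp - bq) * alt ps c * (bp + (bq + \sum_(i <- pts ps) bit (c 0 i)))
  = (bp * bp - bq * bq) * alt ps c
    + (bp - bq) * (alt ps c * (\sum_(i <- pts ps) bit (c 0 i))) by ring.
rewrite IH Hp Hq; ring.
Qed.

Lemma mono_sum A c :
  mono A c * (\sum_(i <- A) bit (c 0 i)) = mono A c * (size A)%:R.
Proof.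
rewrite /mono; elim: A => [|a A IH]; first by rewrite !big_nil.
rewrite !big_cons /= -natr1.
have Ha := bitK (c 0 a); set b := bit _ in Ha *.
set P := \prod_(_ <- _) _ in IH *.
have -> : b * P * (b + \sum_(i <- A) bit (c 0 i))
  = (b * b) * P + b * (P * \sum_(i <- A) bit (c 0 i)) by ring.
rewrite IH Ha; ring.
Qed.

(** Where the product is nonzero, the word covers all of [A] and exactly one point of each pair; the
    rest of its weight lies outside. *)
Lemma mono_alt_sum_out A ps c : uniq (A ++ pts ps) ->
  mono A c * alt ps c * (\sum_(i | i \notin A ++ pts ps) bit (c 0 i))
  = mono A c * alt ps c * ((wt c)%:R - (size A)%:R - (size ps)%:R).
Proof.
move=> U; have := sum_bit c.
rewrite (bigID (mem (A ++ pts ps))) /= -big_uniq //= big_cat /= => <-.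
have EA := mono_sum A c; have Ep := alt_sum_pts ps c.
set a := \sum_(i <- A) _ in EA *; set b := \sum_(i <- pts ps) _ in Ep *.
set s := \sum_(i | _) _.
have -> : mono A c * alt ps c * (a + b + s - (size A)%:R - (size ps)%:R)
  = mono A c * alt ps c * s
    + alt ps c * (mono A c * a - mono A c * (size A)%:R)
    + mono A c * (alt ps c * b - alt ps c * (size ps)%:R) by ring.
by rewrite EA Ep !subrr !mulr0 !addr0.
Qed.

Lemma alt_sum_out ps c : uniq (pts ps) ->
  alt ps c * (\sum_(i | i \notin pts ps) bit (c 0 i))
  = alt ps c * ((wt c)%:R - (size ps)%:R).
Proof.
move=> U; have := @mono_alt_sum_out [::] ps c U.
by rewrite /mono big_nil !mul1r /= subr0.
Qed.

Lemma alt_compl ps c : alt ps (c + const_mx 1) = (-1) ^+ size ps * alt ps c.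
Proof.
elim: ps => [|[p q] ps IH]; first by rewrite /alt !big_nil.
rewrite !altS IH !mxE !bitC /= exprS; ring.
Qed.

Lemma wt_le c : (wt c <= n)%N.
Proof. by rewrite -[leqRHS]card_ord max_card. Qed.

Lemma wt_compl c : wt (c + const_mx 1) = (n - wt c)%N.
Proof.
rewrite /wt.
have -> : supp (c + const_mx 1) = ~: supp c.
  by apply/setP => i; rewrite !inE !mxE; case: (F2_case (c 0 i)) => ->.
by rewrite cardsCs setCK card_ord.
Qed.

Lemma alt_wt_ge ps c : uniq (pts ps) -> alt ps c != 0 -> (size ps <= wt c)%N.
Proof.
move=> U N0; have /(mulfI N0) E := alt_sum_out c U.
have : 0 <= (wt c)%:R - (size ps)%:R :> int by rewrite -E; apply: sumr_ge0.
by rewrite subr_ge0 ler_nat.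
Qed.

Lemma alt_wt_le ps c : uniq (pts ps) -> alt ps c != 0 ->
  (wt c <= n - size ps)%N.
Proof.
move=> U N0; have := @alt_wt_ge ps (c + const_mx 1) U.
rewrite alt_compl mulf_neq0 ?signr_eq0 // wt_compl => /(_ isT).
by have := wt_le c; lia.
Qed.

(** * Characters and the transform of alternating products *)

Lemma sgn_dotb c y : sgn (dotb c y) = \prod_i sgn (c 0 i * y 0 i).
Proof. exact: sgn_sum. Qed.

Lemma dotbDr c y x : dotb c (y + x) = dotb c y + dotb c x.
Proof.
by rewrite /dotb -big_split; apply: eq_bigr => i _; rewrite mxE mulrDr.
Qed.

Lemma dotbDl c y x : dotb (c + x) y = dotb c y + dotb x y.
Proof.
by rewrite /dotb -big_split; apply: eq_bigr => i _; rewrite mxE mulrDl.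
Qed.

Lemma dotb_delta c i : dotb c (delta_mx 0 i) = c 0 i.
Proof.
rewrite /dotb (bigD1 i) //= mxE !eqxx mulr1 big1 ?addr0 // => j ji.
by rewrite mxE (negPf ji) andbF mulr0.
Qed.

(** If [y] is not in the dual, translating [C] by a codeword [c0] with [dotb c0 y = 1] negates every
    term, so the sum equals its opposite. *)
Lemma character_sum (C : {vspace bvec n}) y :
  \sum_(c | c \in C) sgn (dotb c y)
  = if y \in dual_code C then #|C|%:R else 0.
Proof.
case: ifPn; rewrite inE.
  move=> /forallP D; rewrite -sum1_card natr_sum; apply: eq_bigr => c cC.
  by have /implyP/(_ cC)/eqP-> := D c.
move=> /forallPn[c0]; rewrite negb_imply => /andP[c0C c0y].
set S := \sum_(_ | _) _.
have : S = - S.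
  rewrite {1}/S (reindex_inj (addIr c0)) -sumrN.
  apply: eq_big => [c|c _]; first by rewrite rpredDr.
  rewrite dotbDl sgnD.
  case: (F2_case (dotb c0 y)) c0y => -> //= _.
  by rewrite [sgn 1](_ : _ = -1) // mulrN1.
lia.
Qed.

Lemma sum_prod_words (R : comNzRingType) (v : 'I_n -> 'F_2 -> R) :
  \sum_(y : bvec n) \prod_i v i (y 0 i) = \prod_i (v i 0 + v i 1).
Proof.
transitivity (\prod_i \sum_(a : 'F_2) v i a); last first.
  by apply: eq_bigr => i _; rewrite !big_ord_recl big_ord0 addr0;
     congr (v i _ + v i _); apply/val_inj.
rewrite bigA_distr_bigA.
rewrite (reindex (fun f : {ffun 'I_n -> 'F_2} => \row_i f i : bvec n)) /=.
  by apply: eq_bigr => f _; apply: eq_bigr => i _; rewrite mxE.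
exists (fun y : bvec n => [ffun i => y 0 i]) => [f _|y _].
  by apply/ffunP => i; rewrite ffunE mxE.
by apply/rowP => i; rewrite mxE ffunE.
Qed.

(** The sum over the cube factors over coordinates, except that the two points of a pair are
    coupled. The factor of a pair vanishes unless its two bits differ, which leaves a 2 by 2
    determinant of weights. *)
Lemma alt_transform (R : comNzRingType) ps (v : 'I_n -> 'F_2 -> R) :
  uniq (pts ps) ->
  \sum_y (alt ps y)%:~R * \prod_i v i (y 0 i)
  = \prod_(e <- ps) (v e.1 1 * v e.2 0 - v e.1 0 * v e.2 1)
    * \prod_(i | i \notin pts ps) (v i 0 + v i 1).
Proof.
elim: ps v => [|[p q] ps IH] v.
  rewrite big_nil mul1r -sum_prod_words => _; apply: eq_bigr => y _.
  by rewrite /alt big_nil mul1r.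
rewrite /= inE negb_or => /andP[/andP[pq pU]] /andP[qU U].
(* [m x] absorbs the factor [bit (y 0 x)] into the weights [v]. *)
pose m (x : 'I_n) i a := (if i == x then (bit a)%:~R else 1) * v i a.
have mE x y : \prod_i m x i (y 0 i) = (bit (y 0 x))%:~R * \prod_i v i (y 0 i).
  rewrite big_split /= (bigD1 x) //= eqxx big1 ?mulr1 // => i /negPf->//.
have mV x i : i != x -> m x i =1 v i by move=> /negPf ix a; rewrite /m ix mul1r.
have -> : \sum_y (alt ((p, q) :: ps) y)%:~R * \prod_i v i (y 0 i) =
   (\sum_y (alt ps y)%:~R * \prod_i m p i (y 0 i))
   - (\sum_y (alt ps y)%:~R * \prod_i m q i (y 0 i)).
  rewrite -sumrB; apply: eq_bigr => y _.
  rewrite !mE altS rmorphM rmorphB /=; ring.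
rewrite !IH // big_cons /=.
have mP x : x \notin pts ps ->
    \prod_(e <- ps) (m x e.1 1 * m x e.2 0 - m x e.1 0 * m x e.2 1)
    = \prod_(e <- ps) (v e.1 1 * v e.2 0 - v e.1 0 * v e.2 1).
  move=> xU; apply: eq_big_seq => e eps.
  have He z : z \in [:: e.1; e.2] -> z != x.
    move=> ze; apply: contraNneq xU => <-.
    by apply/flattenP; exists [:: e.1; e.2] => //; apply/mapP; exists e.
  by rewrite !mV // He ?inE ?eqxx ?orbT.
rewrite !mP //.
have split2 (F : 'I_n -> R) : \prod_(i | i \notin pts ps) F i
   = F p * (F q * \prod_(i | i \notin [:: p, q & pts ps]) F i).
  rewrite (bigD1 p) //= (bigD1 q) /=; last by rewrite qU eq_sym.
  congr (_ * (_ * _)); apply: eq_bigl => i; rewrite !inE !negb_or.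
  by case: (i == p); case: (i == q); case: (i \in _).
rewrite !split2.
have -> : \prod_(i | i \notin [:: p, q & pts ps]) (m p i 0 + m p i 1)
        = \prod_(i | i \notin [:: p, q & pts ps]) (v i 0 + v i 1).
  by apply: eq_bigr => i; rewrite !inE !negb_or => /andP[ip _]; rewrite !mV.
have -> : \prod_(i | i \notin [:: p, q & pts ps]) (m q i 0 + m q i 1)
        = \prod_(i | i \notin [:: p, q & pts ps]) (v i 0 + v i 1).
  by apply: eq_bigr => i; rewrite !inE !negb_or => /and3P[_ iq _]; rewrite !mV.
rewrite /m !eqxx (negPf pq) eq_sym (negPf pq) !bit0 !bit1 /=; ring.
Qed.

End Words.

(* The truncated subtractions are harmless: a word with [alt ps c != 0] has
   weight between [k] and [n - k], where [k = size ps]. *)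
Definition kraw (n k u : nat) : {poly int} :=
  (1 - 'X) ^+ (u - k) * (1 + 'X) ^+ (n - u - k).

(** * A MacWilliams identity weighted by an alternating product *)

Section MacWilliams.
Variable n : nat.
Implicit Types (c y : bvec n) (ps : seq ('I_n * 'I_n)) (C : {vspace bvec n}).

Lemma size_pts ps : size (pts ps) = (2 * size ps)%N.
Proof. by elim: ps => //= e ps IH; rewrite IH; lia. Qed.

Lemma card_out ps : uniq (pts ps) ->
  #|[pred i | i \notin pts ps]| = (n - 2 * size ps)%N.
Proof.
move=> U; have E := cardC (mem (pts ps)).
rewrite (card_uniqP U) size_pts card_ord in E.
by rewrite -[X in (X - _)%N]E addKn; apply: eq_card => i; rewrite !inE.
Qed.

Lemma pts_size_le ps : uniq (pts ps) -> (2 * size ps <= n)%N.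
Proof. by rewrite -size_pts -[leqRHS]card_ord => /card_uniqP <-; apply: max_card. Qed.

(** With [k = size ps], a word where [alt] is nonzero has [wt c - k] ones off the pairs, each giving
    [1 - 'X], and [n - wt c - k] zeros, each giving [1 + 'X]. *)
Lemma alt_prod_out ps c : uniq (pts ps) ->
  (alt ps c)%:~R * \prod_(i | i \notin pts ps) (1 + (sgn (c 0 i))%:~R * 'X)
  = (alt ps c)%:~R * kraw n (size ps) (wt c) :> {poly int}.
Proof.
move=> U; case: (eqVneq (alt ps c) 0) => [->|N0]; first by rewrite !mul0r.
congr (_ * _).
have Ewt : #|[pred i | i \notin pts ps & i \in supp c]| = (wt c - size ps)%N.
  apply/eqP; rewrite -(eqr_nat int) natrB ?alt_wt_ge //; apply/eqP.
  rewrite -(mulfI N0 (alt_sum_out c U)) -sum1_card natr_sum.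
  rewrite [LHS]big_mkcondr /=; apply: eq_bigr => i _.
  by rewrite /bit inE; case: eqP.
have Eout : #|[pred i | i \notin pts ps & i \notin supp c]|
    = (n - wt c - size ps)%N.
  have H : (#|[pred i | i \notin pts ps & i \in supp c]|
      + #|[pred i | i \notin pts ps & i \notin supp c]| = n - 2 * size ps)%N.
    rewrite -card_out // -!sum1_card; symmetry.
    by rewrite (bigID (mem (supp c))) /=; congr (_ + _)%N;
      apply: eq_bigl => i; rewrite !inE.
  have h1 := alt_wt_ge U N0; have h2 := alt_wt_le U N0; have h3 := wt_le c.
  by move: H; rewrite Ewt; lia.
rewrite (bigID (mem (supp c))) /= /kraw -Ewt -Eout -!prodr_const.
congr (_ * _); apply: eq_bigr => i /andP[_]; rewrite inE /sgn /bit => ic.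
  by rewrite ic /=; ring.
by rewrite (negPf ic) /=; ring.
Qed.

(** Double sum over [c] in [C] and all words [y], with ['X] marking the weight of [y]. Summing over
    [c] first selects the dual words; summing over [y] first is [alt_transform], where the
    determinant of a pair is [-2 * 'X] times the factor of that pair in [alt ps c]. *)
Lemma macwilliams_poly C ps : uniq (pts ps) ->
  #|C|%:R * (\sum_(y in dual_code C) (alt ps y)%:~R * 'X^(wt y))
  = (-2 * 'X) ^+ size ps
    * \sum_(c in C) (alt ps c)%:~R * kraw n (size ps) (wt c) :> {poly int}.
Proof.
move=> U.
pose v c i a : {poly int} := (sgn (c 0 i * a))%:~R * 'X^(a != 0).
have vE c y : \prod_i v c i (y 0 i) = (sgn (dotb c y))%:~R * 'X^(wt y).
  rewrite big_split /= -rmorph_prod -sgn_dotb; congr (_ * _).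
  rewrite prodrXr; congr ('X^_).
  rewrite /wt -sum1_card [RHS]big_mkcond /=.
  by apply: eq_bigr => i _; rewrite inE; case: eqP.
transitivity (\sum_(c in C) \sum_y (alt ps y)%:~R * \prod_i v c i (y 0 i)).
  rewrite exchange_big /= mulr_sumr big_mkcond; apply: eq_bigr => y _.
  under [RHS]eq_bigr => c _ do rewrite vE mulrCA.
  rewrite -mulr_suml -rmorph_sum /= character_sum.
  by case: ifP => _; rewrite ?mul0r ?mulr0 // rmorph_nat.
rewrite mulr_sumr; apply: eq_bigr => c _.
rewrite alt_transform // -alt_prod_out // mulrA; congr (_ * _).
  have -> (z : {poly int}) : z ^+ size ps = \prod_(e <- ps) z.
    by elim: (ps) => [|e l IH]; rewrite ?big_nil // big_cons exprS IH.
  rewrite /alt rmorph_prod -big_split /=.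
  apply: eq_bigr => e _.
  by rewrite /v !mulr0 !mulr1 /sgn /= bit0; ring.
apply: eq_bigr => i _; rewrite /v !mulr0 !mulr1 /sgn bit0 /=; ring.
Qed.

Lemma macwilliams C ps e : uniq (pts ps) ->
  #|C|%:R * (\sum_(y in dual_code C | wt y == (size ps + e)%N) alt ps y)
  = (-2) ^+ size ps
    * \sum_(c in C) alt ps c * (kraw n (size ps) (wt c))`_e :> int.
Proof.
move=> /(macwilliams_poly C) /(congr1 (fun p : {poly int} => p`_(size ps + e))).
have -> : #|C|%:R = (#|C|%:R : int)%:P :> {poly int} by rewrite rmorph_nat.
have -> : (-2 * 'X) ^+ size ps = ((-2) ^+ size ps)%:P * 'X^(size ps) :> {poly int}.
  by rewrite exprMn rmorphXn /= rmorphN /= polyCMn.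
rewrite -mulrA !coefCM coefXnM ltnNge leq_addr /= addKn !coef_sum => E.
have coefZ (a : int) (p : {poly int}) i : (a%:~R * p)`_i = a * p`_i.
  by rewrite mulrzl coefMrz -mulrzl intz.
under [in RHS]eq_bigr => c _ do rewrite -coefZ.
rewrite -{}E; congr (_ * _); rewrite big_mkcondr; apply: eq_bigr => y _.
by rewrite coefZ coefXn eq_sym; case: eqP; rewrite ?mulr1 ?mulr0.
Qed.

(** * Alternating sums over the words of a given weight *)

Definition layer C ps (u : nat) : int := \sum_(c in C | wt c == u) alt ps c.

Lemma sum_layer C ps (F : nat -> int) :
  \sum_(c in C) alt ps c * F (wt c) = \sum_(u < n.+1) layer C ps u * F u.
Proof.
rewrite (partition_big (fun c => inord (wt c) : 'I_n.+1) predT) //=.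
apply: eq_bigr => u _; rewrite /layer mulr_suml; apply: eq_big => [c|c].
  by rewrite -val_eqE /= inordK // ltnS wt_le.
by rewrite -val_eqE /= inordK ?ltnS ?wt_le // => /andP[_ /eqP->].
Qed.

Lemma layer_compl C ps u : const_mx 1 \in C -> (u <= n)%N ->
  layer C ps (n - u) = (-1) ^+ size ps * layer C ps u.
Proof.
move=> C1 un; rewrite /layer (reindex_inj (addIr (const_mx 1))) mulr_sumr.
apply: eq_big => [c|c _]; last exact: alt_compl.
rewrite rpredDr // wt_compl; congr (_ && _).
by have := wt_le c; lia.
Qed.

Lemma layer_neq0 C ps u : uniq (pts ps) -> layer C ps u != 0 ->
  (size ps <= u <= n - size ps)%N /\ exists2 c, c \in C & wt c = u.
Proof.
move=> U; case: (pickP [pred c | [&& c \in C, wt c == u & alt ps c != 0]]).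
  move=> c /and3P[cC /eqP <- N0] _; split; last by exists c.
  by rewrite alt_wt_ge ?alt_wt_le.
move=> N; rewrite /layer big1 ?eqxx // => c /andP[cC cu].
by have := N c; rewrite /= cC cu => /negbFE/eqP.
Qed.

Lemma alt_sgn_sum ps c : uniq (pts ps) ->
  alt ps c * (\sum_(i | i \notin pts ps) sgn (c 0 i))
  = alt ps c * (n%:R - 2 * (wt c)%:R).
Proof.
move=> U; have := alt_sum_out c U; rewrite /sgn sumrB -mulr_sumr.
set s := \sum_(i | _) bit _ => E.
have -> : \sum_(i | i \notin pts ps) (1 : int) = n%:R - 2 * (size ps)%:R.
  rewrite (eq_bigl (mem [pred i | i \notin pts ps])) //.
  by rewrite sumr_const card_out // natrB ?pts_size_le // natrM.
have -> : alt ps c * (n%:R - 2 * (size ps)%:R - 2 * s) =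
   alt ps c * (n%:R - 2 * (size ps)%:R) - 2 * (alt ps c * s) by ring.
by rewrite E; ring.
Qed.

Lemma supp_addU y i : y 0 i = 0 -> supp (y + delta_mx 0 i) = i |: supp y.
Proof.
move=> yi; apply/setP => j; rewrite !inE !mxE eqxx /=.
by case: (j =P i) => [->|_]; rewrite ?addr0 // yi.
Qed.

Lemma wt_add_le y (i : 'I_n) : (wt (y + delta_mx 0 i)%R <= (wt y).+1)%N.
Proof.
apply: leq_trans (_ : #|i |: supp y| <= _)%N; last first.
  by rewrite cardsU1; case: (i \notin _).
apply/subset_leq_card/subsetP => j; rewrite !inE !mxE eqxx /=.
by case: (j =P i); rewrite //= addr0.
Qed.

(** * Vanishing of moments below the dual distance *)

Section Moments.
Variables (C : {vspace bvec n}) (dp : nat).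
Hypothesis dualC : forall y, y \in dual_code C -> y != 0 -> (dp <= wt y)%N.

(** Multiplied by -2, the factor of a pair is the difference of the characters at its two points, so
    each pair moves one coordinate into [y]; disjointness keeps that coordinate from cancelling.
    What remains is a nontrivial character of weight below [dp], whose sum over [C] is zero. *)
Lemma moment_base ps y : uniq (pts ps) -> [disjoint supp y & pts ps] ->
  (y != 0) || (0 < size ps)%N -> (wt y + size ps < dp)%N ->
  \sum_(c in C) sgn (dotb c y) * alt ps c = 0.
Proof.
elim: ps y => [|[p q] ps IH] y.
  rewrite orbF addn0 => _ _ y0 wy.
  under eq_bigr => c _ do rewrite /alt big_nil mulr1.
  rewrite character_sum; case: ifP => // /dualC/(_ y0).
  by rewrite leqNgt wy.
rewrite /= inE negb_or => /andP[/andP[pq pU]] /andP[qU U] D _ wy.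
have step x : x \in [:: p; q] ->
   \sum_(c in C) sgn (dotb c (y + delta_mx 0 x)) * alt ps c = 0.
  move=> xpq; have xy : x \notin supp y.
    by have := disjointFl D (x := x); rewrite !inE in xpq *; case/orP: xpq => /eqP->;
      rewrite eqxx ?orbT => /(_ isT)/negbT.
  have yx : y 0 x = 0 by apply/eqP; rewrite inE negbK in xy.
  apply: IH => //.
  - rewrite disjoint_subset; apply/subsetP => i; rewrite supp_addU // !inE.
    case/orP => [/eqP->|iy]; first by move: xpq; rewrite !inE => /orP[] /eqP->.
    apply: contraTN iy => ips.
    by have := disjointFl D (x := i); rewrite !inE ips !orbT => /(_ isT)/negbT.
  - apply/orP; left; apply/eqP => E.
    have : x \in supp (y + delta_mx 0 x) by rewrite supp_addU // setU11.
    by rewrite E inE mxE eqxx.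
  - by have := wt_add_le y x; lia.
have E : -2 * (\sum_(c in C) sgn (dotb c y) * alt ((p, q) :: ps) c) = 0.
  transitivity ((\sum_(c in C) sgn (dotb c (y + delta_mx 0 p)) * alt ps c)
     - \sum_(c in C) sgn (dotb c (y + delta_mx 0 q)) * alt ps c).
    rewrite -sumrB mulr_sumr; apply: eq_bigr => c _.
    rewrite !dotbDr !sgnD !dotb_delta altS; set s := sgn (dotb c y).
    by rewrite /sgn; ring.
  by rewrite !step ?inE ?eqxx ?orbT // subrr.
by apply/eqP; move/eqP: E; rewrite mulf_eq0.
Qed.

(** Each factor [wt c - u] costs one unit of the budget [dp], because a character [sgn (c 0 i)]
    raises the weight of [y] by at most one. The point [i] may already lie in the support of [y], so
    [y] may become zero; the presence of a pair still makes [moment_base] applicable. *)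
Lemma moment_char ps us y : uniq (pts ps) -> [disjoint supp y & pts ps] ->
  (0 < size ps)%N -> (wt y + size ps + size us < dp)%N ->
  \sum_(c in C) sgn (dotb c y) * alt ps c
     * \prod_(u <- us) ((wt c)%:R - u%:R) = 0.
Proof.
move=> U D s0; elim: us y D => [|u us IH] y D wy.
  rewrite -[RHS](@moment_base ps y) ?s0 ?orbT //; last by rewrite addn0 in wy.
  by apply: eq_bigr => c _; rewrite big_nil mulr1.
pose P c : int := \prod_(v <- us) ((wt c)%:R - v%:R).
(* On the support of [alt], [2 (wt c - u)] is a combination of characters [sgn (c 0 i)]. *)
have E : 2 * (\sum_(c in C) sgn (dotb c y) * alt ps c
          * \prod_(v <- u :: us) ((wt c)%:R - v%:R)) = 0.
  transitivity ((n%:R - 2 * u%:R) * (\sum_(c in C) sgn (dotb c y) * alt ps c * P c)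
    - \sum_(i | i \notin pts ps)
        \sum_(c in C) sgn (dotb c (y + delta_mx 0 i)) * alt ps c * P c).
    rewrite exchange_big /= !mulr_sumr -sumrB; apply: eq_bigr => c _.
    under [X in _ - X]eq_bigr => i _ do
      rewrite dotbDr sgnD dotb_delta -[_ * sgn _ * _]mulrA mulrAC
        [sgn _ * alt _ _]mulrC mulrA.
    rewrite -mulr_sumr big_cons -/(P c).
    have Es := alt_sgn_sum c U; set T := \sum_(i | _) _ in Es *.
    set s := sgn _.
    have -> : s * P c * alt ps c * T = s * P c * (alt ps c * T) by ring.
    by rewrite Es; ring.
  rewrite IH //=; last by move: wy => /=; lia.
  rewrite mulr0 sub0r big1 ?oppr0 // => i ips; apply: IH.
    rewrite disjoint_subset; apply/subsetP => j; rewrite !inE !mxE eqxx /=.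
    case: (j =P i) => [->|_] //; rewrite addr0 => jy.
    apply: contraTN jy => jps.
    by have := disjointFl D jps; rewrite inE => /negbT.
  by have := wt_add_le y i; move: wy => /=; lia.
by apply/eqP; move/eqP: E; rewrite mulf_eq0.
Qed.

Lemma moment ps us : uniq (pts ps) ->
  (0 < size ps)%N -> (size ps + size us < dp)%N ->
  \sum_(c in C) alt ps c * \prod_(u <- us) ((wt c)%:R - u%:R) = 0.
Proof.
move=> U s0 wy; rewrite -[RHS](@moment_char ps us 0) //.
- apply: eq_bigr => c _; rewrite (_ : dotb c 0 = 0) ?mul1r //.
  by apply: big1 => i _; rewrite mxE mulr0.
- by rewrite disjoint_subset; apply/subsetP => i; rewrite !inE mxE eqxx.
- by rewrite (_ : wt 0 = 0%N) //;
    apply/eqP; rewrite cards_eq0; apply/eqP/setP => i; rewrite !inE mxE eqxx.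
Qed.

Lemma sum_layer0 ps : uniq (pts ps) -> (0 < size ps < dp)%N ->
  \sum_(u < n.+1) layer C ps u = 0.
Proof.
move=> U /andP[s0 sd].
have E := @moment ps [::] U s0; rewrite addn0 in E.
transitivity (\sum_(c in C) alt ps c * 1).
  rewrite (sum_layer C ps (fun=> 1)).
  by apply: eq_bigr => i _; rewrite mulr1.
by rewrite -[RHS](E sd); apply: eq_bigr => c _; rewrite big_nil.
Qed.

(** Write [k = size ps]. The words with nonzero [alt] have weights in [L]: the [dp - t] weights of
    [C] up to [n - t], and the [t - k] values above [n - t] up to [n - k]. Dropping [u] leaves at
    most [dp - k - 1] roots, so the polynomial with these roots has a vanishing moment; only the
    layer of weight [u] survives in it, with a nonzero coefficient. *)
Lemma layer_small ps t u : uniq (pts ps) -> (0 < size ps <= t)%N ->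
  (t < dp)%N -> (dp - t)%N = nb_weights C t -> layer C ps u = 0.
Proof.
move=> U /andP[s0 st] tdp cnt; apply/eqP/negPn/negP => N0.
set E := [set v : 'I_n.+1 | (0 < v <= n - t)%N &&
       [exists c : bvec n, (c \in C) && (wt c == v)]].
pose L := map val (enum E) ++ iota (n - t).+1 (t - size ps).
have inL c : c \in C -> alt ps c != 0 -> wt c \in L.
  move=> cC c0; have H1 := alt_wt_ge U c0; have H2 := alt_wt_le U c0.
  rewrite mem_cat mem_iota; case: (leqP (wt c) (n - t)) => H3; apply/orP.
    left; apply/mapP; exists (inord (wt c)); last by rewrite /= inordK // ltnS wt_le.
    rewrite mem_enum inE inordK ?ltnS ?wt_le //.
    by apply/andP; split; [lia | apply/existsP; exists c; rewrite cC /=].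
  by right; lia.
(* [us] annihilates every layer except the one of weight [u]. *)
pose us := [seq v <- L | v != u].
have uL : u \in L.
  case: (pickP [pred c | [&& c \in C, wt c == u & alt ps c != 0]]).
    by move=> c /and3P[cC /eqP <- c0]; apply: inL.
  move=> N; move: N0; rewrite /layer big1 ?eqxx // => c /andP[cC cu].
  by have := N c; rewrite /= cC cu => /negbFE/eqP.
have sz : (size ps + size us < dp)%N.
  have : (size us < size L)%N.
    by rewrite size_filter -(count_predC (pred1 u) L) -[ltnLHS]add0n
      ltn_add2r -has_count has_pred1.
  rewrite /L size_cat size_map size_iota -cardE -/(nb_weights C t) -cnt; lia.
have := moment U s0 sz.
rewrite (bigID (fun c => wt c == u)) /= [X in _ + X]big1 ?addr0; last first.
  move=> c /andP[cC cu]; case: (eqVneq (alt ps c) 0) => [->|c0]; first by rewrite mul0r.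
  rewrite (big_rem (wt c)) /= ?subrr ?mul0r ?mulr0 // mem_filter cu inL //.
rewrite (eq_bigr (fun c => alt ps c * \prod_(v <- us) (u%:R - v%:R)));
  last by move=> c /andP[_ /eqP->].
rewrite -mulr_suml => /eqP; rewrite mulf_eq0 (negPf N0) /= prodf_seq_eq0.
by case/hasP => v; rewrite mem_filter /= subr_eq0 eqr_nat eq_sym => /andP[/negPf->].
Qed.

End Moments.
End MacWilliams.

(** * Explicit coefficients of the transform *)

Section Coefficients.

(** For [b <= 1] this is the coefficient of ['X^(2 * w + b)] in
    [(1 - 'X^2) ^+ m * (1 + 'X) ^+ N]. *)
Definition kraw_coef (m N b w : nat) : int :=
  \sum_(0 <= i < w.+1) (-1) ^+ (w - i) * ('C(m, w - i))%:Z * ('C(N, 2 * i + b))%:Z.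

Lemma expr1D_wide (R : comNzRingType) (y : R) m M : (m < M)%N ->
  (1 + y) ^+ m = \sum_(0 <= j < M) y ^+ j *+ 'C(m, j).
Proof.
move=> mM; rewrite exprDn (big_cat_nat (n := m.+1)) //= [X in _ + X]big_nat_cond.
rewrite [X in _ + X]big1 => [|j]; last by case/andP => /andP[mj _] _; rewrite bin_small.
by rewrite addr0 big_mkord; apply: eq_bigr => j _; rewrite expr1n mul1r.
Qed.

Lemma coef_expr1D (s : int) N i : ((1 + s%:P * 'X) ^+ N)`_i = s ^+ i * 'C(N, i)%:R.
Proof.
rewrite (@expr1D_wide _ _ N (maxn N i).+1) ?ltnS ?leq_maxl // coef_sum.
rewrite (bigD1_seq i) ?iota_uniq ?mem_index_iota ?ltnS ?leq_maxr //=.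
rewrite big1 ?addr0 => [|j ji].
  by rewrite coefMn exprMn -rmorphXn coefCM coefXn eqxx mulr1 mulr_natr.
by rewrite coefMn exprMn -rmorphXn coefCM coefXn eq_sym (negPf ji) mulr0 mul0rn.
Qed.

(** The first factor has even powers only, so the second contributes an exponent of the parity of
    [b], and the sign [s] enters as [s ^+ b]. *)
Lemma coef_product m N (s : int) b w : s * s = 1 -> (b <= 1)%N ->
  ((1 - 'X ^+ 2) ^+ m * (1 + s%:P * 'X) ^+ N)`_(2 * w + b)
  = s ^+ b * kraw_coef m N b w.
Proof.
move=> s1 b1; set q := (1 + _) ^+ N.
(* The bound exceeds both [m] and [w], so the range can be cut after [w]; the later terms have
   degree above [2 * w + b]. *)
rewrite (@expr1D_wide _ _ m (m + w).+1) ?ltnS ?leq_addr // mulr_suml coef_sum.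
have mw : (w.+1 <= (m + w).+1)%N by rewrite ltnS leq_addl.
have cE j : ((- 'X^2) ^+ j *+ 'C(m, j) * q)`_(2 * w + b)
   = (-1) ^+ j * 'C(m, j)%:Z
     * (if (2 * w + b < 2 * j)%N then 0 else q`_(2 * w + b - 2 * j)).
  rewrite mulrnAl coefMn [(- 'X^2) ^+ j]exprNn -exprM -mulrA.
  rewrite (_ : (-1) ^+ j = ((-1) ^+ j)%:P :> {poly int});
    last by rewrite rmorphXn /= rmorphN.
  by rewrite coefCM coefXnM -mulr_natr natz; set z := if _ then _ else _; ring.
rewrite (big_cat_nat (n := w.+1)) //= [X in _ + X]big_nat_cond.
rewrite [X in _ + X]big1 ?addr0 => [|j /andP[/andP[wj _] _]]; last first.
  by rewrite cE ifT ?mulr0 //; lia.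
rewrite /kraw_coef mulr_sumr big_nat_rev /= add0n.
rewrite big_nat_cond [RHS]big_nat_cond; apply: eq_bigr => i /andP[/andP[_ iw] _].
rewrite subSS cE ifF; last by lia.
rewrite (_ : 2 * w + b - 2 * (w - i) = 2 * i + b)%N; last by lia.
rewrite coef_expr1D exprD exprM (_ : s ^+ 2 = 1) // expr1n mul1r natz; ring.
Qed.

(** Pairing the [u - k] factors [1 - 'X] with as many factors [1 + 'X] gives powers of [1 - 'X^2]
    and leaves [(1 + 'X) ^+ (n - 2 * u)]. For the complementary weight the leftover base is
    [1 - 'X], whence the sign in [kraw_upper]. *)
Lemma kraw_lower n k u b w : (k <= u)%N -> (2 * u <= n)%N -> (b <= 1)%N ->
  (kraw n k u)`_(2 * w + b) = kraw_coef (u - k) (n - 2 * u) b w.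
Proof.
move=> ku un b1; rewrite /kraw.
rewrite (_ : n - u - k = (u - k) + (n - 2 * u))%N; last by lia.
rewrite exprD mulrA -exprMn.
rewrite (_ : (1 - 'X) * (1 + 'X) = 1 - 'X^2); last by ring.
rewrite (_ : 1 + 'X = 1 + 1%:P * 'X); last by rewrite polyC1 mul1r.
by rewrite (coef_product _ _ _ (mulr1 1)) // expr1n mul1r.
Qed.

Lemma kraw_upper n k u b w : (k <= u)%N -> (2 * u <= n)%N -> (b <= 1)%N ->
  (kraw n k (n - u))`_(2 * w + b) = (-1) ^+ b * kraw_coef (u - k) (n - 2 * u) b w.
Proof.
move=> ku un b1; rewrite /kraw.
rewrite (_ : n - (n - u) - k = u - k)%N; last by lia.
rewrite (_ : n - u - k = (n - 2 * u) + (u - k))%N; last by lia.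
rewrite exprD -mulrA -exprMn mulrC.
rewrite (_ : (1 - 'X) * (1 + 'X) = 1 - 'X^2); last by ring.
rewrite (_ : 1 - 'X = 1 + (-1)%:P * 'X); last by rewrite rmorphN /= polyC1 mulN1r.
by rewrite coef_product.
Qed.

(** The case of the middle weight [n / 2], where no power of [1 + 'X] is left over and only [i = 0]
    contributes. *)
Lemma kraw_coef0 m w : kraw_coef m 0 0 w = (-1) ^+ w * 'C(m, w)%:Z.
Proof.
rewrite /kraw_coef big_ltn // subn0 muln0 addn0 bin0 mulr1 big_nat_cond.
rewrite big1 ?addr0 // => i /andP[/andP[i0 _] _].
by rewrite ['C(0, _)]bin_small ?mulr0 //; lia.
Qed.

End Coefficients.

Lemma sum_supported n (L : seq nat) (f : nat -> int) :
  uniq L -> {in L, forall u, u <= n}%N -> (forall u, f u != 0 -> u \in L) ->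
  \sum_(u < n.+1) f u = \sum_(u <- L) f u.
Proof.
move=> UL Ln sL.
have E : perm_eq L [seq u <- iota 0 n.+1 | u \in L].
  apply: uniq_perm => //; first by rewrite filter_uniq ?iota_uniq.
  by move=> u; rewrite mem_filter mem_iota /= ltnS; case: (boolP (u \in L)) => // /Ln ->.
rewrite (perm_big _ E) big_filter [RHS]big_mkcond.
rewrite -[iota 0 n.+1]/(index_iota 0 n.+1) big_mkord.
apply: eq_bigr => u _; case: ifPn => // uL.
by apply/eqP; apply: contraNT uL; apply: sL.
Qed.

(** * From vanishing alternating sums to designs *)

Section Design.
Variables (n : nat) (S : {set bvec n}) (W r : nat).
Hypothesis altS0 : forall ps, uniq (pts ps) -> (0 < size ps <= r)%N ->
  \sum_(y in S | wt y == W) alt ps y = 0.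

Lemma mono_alt_sum0 A (ps : seq ('I_n * 'I_n)) : uniq (A ++ pts ps) ->
  (0 < size ps)%N -> (size A + size ps <= r)%N ->
  \sum_(y in S | wt y == W) mono A y * alt ps y = 0.
Proof.
elim: A ps => [|x A IH] ps.
  move=> U s0 sr; rewrite -[RHS](@altS0 ps) ?s0 //.
  by apply: eq_bigr => y _; rewrite /mono big_nil mul1r.
rewrite /= => /andP[xU U] s0 sr.
(* Replacing [x] by [x'] costs an alternating sum with the extra pair [(x', x)];
   averaging over [x'] then reduces [x :: A] to [A]. *)
have same x' : x' \notin A ++ pts ps ->
    \sum_(y in S | wt y == W) mono (x' :: A) y * alt ps y
    = \sum_(y in S | wt y == W) mono (x :: A) y * alt ps y.
  move=> xU'; case: (eqVneq x' x) => [->//|xx].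
  apply/eqP; rewrite -subr_eq0 -sumrB; apply/eqP.
  rewrite -[RHS](IH ((x', x) :: ps)) //; last by rewrite /=; lia.
    by apply: eq_bigr => y _; rewrite altS /mono !big_cons /=; ring.
  move: U xU xU'; rewrite -[pts (_ :: _)]/[:: x', x & pts ps] !cat_uniq /=
    !mem_cat !inE !negb_or.
  move=> /and3P[-> hA ->] /andP[-> xp] /andP[-> ->] /=.
  by rewrite xx xp hA.
have : \sum_(x' | x' \notin A ++ pts ps)
    \sum_(y in S | wt y == W) mono (x' :: A) y * alt ps y = 0.
  rewrite exchange_big /=.
  transitivity (\sum_(y in S | wt y == W)
      mono A y * alt ps y * (W%:R - (size A)%:R - (size ps)%:R)).
    apply: eq_bigr => y /andP[_ /eqP <-]; rewrite -mono_alt_sum_out // mulr_sumr.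
    by apply: eq_bigr => i _; rewrite /mono big_cons; ring.
  by rewrite -mulr_suml IH ?mul0r //; lia.
(* All inner sums agree, so the total is a multiple of the wanted sum; the multiplicity is nonzero
   because [x] itself is one of the choices. *)
rewrite (eq_bigr _ same) (eq_bigl (mem [pred i | i \notin A ++ pts ps])) //.
rewrite sumr_const => /eqP; rewrite mulrn_eq0 => /orP[|/eqP//].
move/eqP/card0_eq/(_ x); rewrite !inE => E; by rewrite E in xU.
Qed.

(** A binary word is determined by its support, so blocks can be counted by words. *)
Lemma blocks_count (T : {set 'I_n}) : #|[set b in support_blocks S W | T \subset b]|
  = #|[set y in S | (wt y == W) && (T \subset supp y)]|.
Proof.
rewrite -(card_in_imset (f := @supp n)); last first.
  move=> y z _ _ /setP E; apply/rowP => i; have := E i; rewrite !inE.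
  by case: (F2_case (y 0 i)) => ->; case: (F2_case (z 0 i)) => ->.
apply: eq_card => b; rewrite !inE; apply/andP/imsetP.
  case=> /imsetP[y]; rewrite inE => /andP[yS yW] -> Ty.
  by exists y; rewrite ?inE ?yS ?yW.
case=> y; rewrite inE => /and3P[yS yW Ty] ->; split => //.
by apply/imsetP; exists y; rewrite ?inE ?yS.
Qed.

Lemma mono_supp (T : {set 'I_n}) y : mono (enum T) y = (T \subset supp y)%:R.
Proof.
rewrite /mono; case: (boolP (T \subset supp y)) => [/subsetP H|/subsetPn[i iT iy]].
  rewrite big1_seq // => i; rewrite mem_enum => /andP[_ /H].
  by rewrite inE /bit => ->.
apply/eqP; rewrite prodf_seq_eq0; apply/hasP; exists i; rewrite ?mem_enum //=.
by move: iy; rewrite inE /bit negbK => ->.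
Qed.

Lemma blocks_count_sum (T : {set 'I_n}) :
  #|[set b in support_blocks S W | T \subset b]|%:R
  = \sum_(y in S | wt y == W) mono (enum T) y.
Proof.
rewrite blocks_count -sum1_card natr_sum.
under [RHS]eq_bigr => y _ do rewrite mono_supp.
rewrite [LHS]big_mkcond [RHS]big_mkcond; apply: eq_bigr => y _.
by rewrite inE; case: (y \in S); case: (wt y == W); case: (T \subset _).
Qed.

(** The two counts differ by the sum of the monomial of [B] times the factor of the single pair
    [(p, q)]. *)
Lemma blocks_swap (B : {set 'I_n}) p q : (#|B|.+1 = r)%N ->
  p \notin B -> q \notin B ->
  #|[set b in support_blocks S W | p |: B \subset b]|
  = #|[set b in support_blocks S W | q |: B \subset b]|.
Proof.
move=> Br pB qB; case: (eqVneq p q) => [->//|pq].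
apply/eqP; rewrite -(eqr_nat int) !blocks_count_sum -subr_eq0 -sumrB; apply/eqP.
rewrite -[RHS](@mono_alt_sum0 (enum B) [:: (p, q)]) //.
- apply: eq_bigr => y _; rewrite /alt big_seq1 /=.
  have mE z : z \notin B -> mono (enum (z |: B)) y = bit (y 0 z) * mono (enum B) y.
    move=> zB; rewrite /mono.
    by rewrite big_enum big_setU1 //= big_enum.
  by rewrite !mE //; ring.
- by rewrite cat_uniq enum_uniq /= !mem_enum !inE (negPf pB) (negPf qB) pq.
- by rewrite -cardE /= addn1 Br.
Qed.

(** Any two [r]-subsets are joined by exchanges of one point, each preserving the count; the
    induction is on the size of [T :\: T']. *)
Lemma design_of_alt : (0 < r)%N -> is_design r (support_blocks S W).
Proof.
move=> r0; pose f (T : {set 'I_n}) := #|[set b in support_blocks S W | T \subset b]|.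
have conn m (T T' : {set 'I_n}) : #|T| = r -> #|T'| = r -> #|T :\: T'| = m -> f T = f T'.
  elim: m T => [|m IH] T cT cT' /eqP.
    rewrite cards_eq0 setD_eq0 => sT.
    by congr f; apply/eqP; rewrite eqEcard sT cT cT' leqnn.
  move=> /eqP cD; have /card_gt0P[p] : (0 < #|T :\: T'|)%N by rewrite cD.
  rewrite inE => /andP[pT' pT].
  have : (0 < #|T' :\: T|)%N.
    have := cardsID T' T; have := cardsID T T'; rewrite setIC; lia.
  case/card_gt0P => q; rewrite inE => /andP[qT qT'].
  have cp : #|T :\ p| = r.-1 by have := cardsD1 p T; rewrite pT cT; lia.
  have qTp : q \notin T :\ p by rewrite !inE (negPf qT) andbF.
  have pTp : p \notin T :\ p by rewrite !inE eqxx.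
  rewrite -(setD1K pT) /f (blocks_swap _ pTp qTp) ?cp ?prednK //.
  apply: IH => //; first by rewrite cardsU1 qTp cp; lia.
  have -> : (q |: (T :\ p)) :\: T' = (T :\: T') :\ p.
    apply/setP => i; rewrite !inE; case: (eqVneq i q) => [->|_] /=.
      by rewrite qT' andbF.
    by case: (i == p); case: (i \in T'); case: (i \in T).
  by have := cardsD1 p (T :\: T'); rewrite inE pT pT' cD /=; lia.
(* Without any [r]-subset, every constant would serve. *)
case: (pickP [pred T : {set 'I_n} | #|T| == r]) => [T0 /= /eqP c0|N].
  by exists (f T0) => T cT; apply: conn.
by exists 0%N => T cT; have := N T; rewrite /= cT eqxx.
Qed.

End Design.

(** * The layers in degree [t + 1] *)

Definition is_weight n (C : {vspace bvec n}) u := exists2 c, c \in C & wt c = u.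

Section TopDegree.
Variables (n : nat) (C : {vspace bvec n}) (d dp t : nat).
Hypothesis hdp : is_min_dist (dual_code C) dp.
Hypothesis ht : (0 < t < dp)%N.
Hypothesis hcount : (dp - t)%N = nb_weights C t.

Lemma dual_min y : y \in dual_code C -> y != 0 -> (dp <= wt y)%N.
Proof. by case: hdp => _; apply. Qed.

(** With at most [t] pairs the layers of [C] vanish by [layer_small], so only the sums with [t + 1]
    pairs remain to be checked. *)
Lemma dual_design e :
  (forall ps, uniq (pts ps) -> size ps = t.+1 ->
     \sum_(u < n.+1) layer C ps u * (kraw n t.+1 u)`_e = 0) ->
  is_design t.+1 (support_blocks (dual_code C) (e + t.+1)).
Proof.
move=> H; apply: design_of_alt => // ps U /andP[s0 st].
have C0 : (#|C|%:R : int) != 0.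
  by rewrite pnatr_eq0 -lt0n; apply/card_gt0P; exists 0; rewrite mem0v.
apply/eqP; rewrite -(mulrI_eq0 _ (mulfI C0)); apply/eqP.
rewrite (_ : e + t.+1 = size ps + (e + t.+1 - size ps))%N; last by lia.
rewrite macwilliams //
  (sum_layer C ps (fun u => (kraw n (size ps) u)`_(e + t.+1 - size ps))).
case: (eqVneq (size ps) t.+1) => [E|sN].
  by rewrite E addnK H // mulr0.
rewrite big1 ?mulr0 // => u _; rewrite (@layer_small _ C dp dual_min ps t) ?mul0r //.
  by rewrite s0 /=; lia.
by case/andP: ht.
Qed.

Hypothesis hone : const_mx (1 : 'F_2) \in C.
Hypothesis hd : is_min_dist [set c : bvec n | c \in C] d.

Lemma weights_bound (s : seq nat) : uniq s ->
  (forall u, u \in s -> (0 < u <= n - t)%N /\ is_weight C u) ->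
  (size s <= dp - t)%N.
Proof.
move=> Us sP; rewrite hcount /nb_weights.
have lt u : u \in s -> (u < n.+1)%N 
  by move=> /sP[/andP[_ h] _]; rewrite ltnS (leq_trans h) ?leq_subr.
rewrite cardE -(size_map (inord : nat -> 'I_n.+1) s); apply: uniq_leq_size.
  rewrite map_inj_in_uniq // => u v us vs /(congr1 val).
  by rewrite /= !inordK ?lt.
move=> _ /mapP[u us ->]; rewrite mem_enum inE inordK ?lt //.
have [h [c cC cu]] := sP u us; rewrite h; apply/existsP; exists c.
by rewrite cC cu eqxx.
Qed.

Lemma min_weight : (0 < d)%N /\ is_weight C d.
Proof.
case: hd => [[c]]; rewrite inE => cC /andP[c0 /eqP cd] _; split; last by exists c.
rewrite -cd lt0n; apply: contra_neq c0 => /eqP; rewrite cards_eq0 => /eqP E.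
apply/rowP => i; have := in_set0 i; rewrite -E inE mxE => /negbFE/eqP //.
Qed.

Lemma min_weight_le u : (0 < u)%N -> is_weight C u -> (d <= u)%N.
Proof.
move=> u0 [c cC cu]; case: hd => _ /(_ c); rewrite inE cC => /(_ isT).
rewrite cu; apply; apply: contraTneq u0 => c0.
rewrite -cu c0 -leqNgt leqn0 cards_eq0; apply/eqP/setP => i.
by rewrite !inE mxE eqxx.
Qed.

Section Harmonic.
Variable ps : seq ('I_n * 'I_n).
Hypothesis U : uniq (pts ps).
Hypothesis sps : size ps = t.+1.

Let f := layer C ps.

Lemma layer_weight u : f u != 0 ->
  [/\ (0 < u <= n - t)%N, is_weight C u, (t < u <= n)%N, (d <= u)%N
    & f (n - u) = (-1) ^+ t.+1 * f u].
Proof.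
move=> u0; have [] := layer_neq0 U u0; rewrite sps => /andP[a b] hw.
have un : (u <= n)%N by apply: leq_trans b _; rewrite leq_subr.
split => //; try lia; last by rewrite /f layer_compl // sps.
by apply: min_weight_le => //; lia.
Qed.

Lemma layer_opp_neq0 u : f u != 0 -> f (n - u) != 0.
Proof.
by move=> u0; have [_ _ _ _ ->] := layer_weight u0; rewrite mulf_neq0 ?signr_eq0.
Qed.

Lemma layers_bound (s : seq nat) : uniq s ->
  (forall u, u \in s -> u = d \/ f u != 0) -> (exists2 v, v \in s & f v != 0) ->
  (size s <= dp - t)%N.
Proof.
move=> Us sP [v vs v0]; apply: weights_bound => // u /sP[->|]; last by case/layer_weight.
have [d0 dw] := min_weight.
by have [/andP[_ h] _ _ dv _] := layer_weight v0; split=> //; lia.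
Qed.

(** Complementation is antisymmetric here, which kills the middle layer. A nonzero layer [u] thus
    brings a distinct partner [n - u], and these two exhaust the bound [dp - t = 2]; so [d] is the
    smaller of them. *)
Lemma layers_two : dp = t.+2 -> odd t.+1 ->
  (forall u, f u = 0) \/
  [/\ (t < d)%N, (2 * d < n)%N, f (n - d) = - f d
    & forall u, f u != 0 -> u \in [:: d; (n - d)%N]].
Proof.
move=> dpt ot; have lim : (dp - t = 2)%N by lia.
have opp u : f u != 0 -> f (n - u) = - f u.
  by move=> /layer_weight[_ _ _ _ ->]; rewrite -signr_odd ot mulN1r.
have mid u : f u != 0 -> (2 * u)%N != n.
  move=> u0; apply: contra_neq u0 => E; have := @opp u.
  rewrite (_ : n - u = u)%N; last by lia.
  case: (eqVneq (f u) 0) => // _ /(_ isT); lia.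
case: (boolP [exists u : 'I_n.+1, f u != 0]) => [/existsP[u u0]|/existsPn N]; last first.
  left=> u; apply/eqP/negPn/negP => u0; have [_ _ /andP[_ un] _ _] := layer_weight u0.
  by have /= := N (Ordinal (n:=n.+1) (m:=u) un); rewrite u0.
move: (val u) u0 => {}u u0; right.
have nu := layer_opp_neq0 u0; have mu := mid u u0.
have [_ _ /andP[tu un] du _] := layer_weight u0.
have [_ _ /andP[tu' _] du' _] := layer_weight nu.
have two v : v = d \/ f v != 0 -> v \in [:: u; (n - u)%N].
  move=> hv; apply/negPn/negP => vN.
  have := @layers_bound [:: v; u; (n - u)%N]; rewrite lim ltnn.
  move=> F; suff: false by []. apply: F; last by exists u; rewrite ?inE ?eqxx ?orbT.
    by rewrite /= vN !inE; apply/andP; split=> //; lia.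
  by move=> x; rewrite !inE => /or3P[] /eqP->; auto.
have dE := two d (or_introl erefl).
have d0 : f d != 0 by move: dE; rewrite !inE => /orP[] /eqP->.
split; rewrite ?opp //.
- by have [_ _ /andP[]] := layer_weight d0.
- lia.
- by move=> v v0; have := two v (or_intror v0); move: dE; rewrite !inE; lia.
Qed.

(** Complementation is symmetric here and the layers sum to zero. Three weights must then occur: a
    complementary pair and the middle weight. The smaller of the pair is [d], and the zero total
    determines the middle layer. *)
Lemma layers_three : dp = t.+3 -> ~~ odd t.+1 ->
  (forall u, f u = 0) \/
  [/\ (t < d)%N, (2 * d < n)%N, f (n - d) = f d, f n./2 = - 2 * f d
    & n = (2 * n./2)%N /\ forall u, f u != 0 -> u \in [:: d; (n - d)%N; n./2]].
Proof.
move=> dpt ot; have lim : (dp - t = 3)%N by lia.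
have sum0 : \sum_(u < n.+1) f u = 0.
  by apply: (sum_layer0 dual_min) => //; rewrite sps dpt; lia.
have opp u : f u != 0 -> f (n - u) = f u.
  by move=> /layer_weight[_ _ _ _ ->]; rewrite -signr_odd (negPf ot) mul1r.
have le_n u : f u != 0 -> (u <= n)%N by case/layer_weight => _ _ /andP[].
case: (boolP [exists u : 'I_n.+1, f u != 0]) => [/existsP[u' u'0]|/existsPn N]; last first.
  left=> u; apply/eqP/negPn/negP => u0.
  by have /= := N (Ordinal (n:=n.+1) (m:=u) (le_n u u0)); rewrite u0.
right.
(* Otherwise the zero total would consist of the middle layer alone. *)
have [u u0 mu] : exists2 u, f u != 0 & (2 * u)%N != n.
  case: (boolP [exists u : 'I_n.+1, (f u != 0) && (2 * u != n)%N]) =>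
    [/existsP[u /andP[]]|/existsPn N].
    by exists u.
  have := sum0; rewrite (@sum_supported n [:: val u'] f) //.
  - by rewrite big_seq1 => E; move: u'0; rewrite E eqxx.
  - by move=> v; rewrite inE => /eqP->; apply: le_n.
  - move=> v v0; have := N (Ordinal (n:=n.+1) (m:=v) (le_n v v0)); rewrite /= v0 /= negbK.
    by have := N u'; rewrite u'0 /= negbK inE; lia.
have nu := layer_opp_neq0 u0.
have [_ _ /andP[tu un] du _] := layer_weight u0.
have [_ _ /andP[tu' _] du' _] := layer_weight nu.
(* Otherwise the zero total would be [2 * f u]. *)
have [v v0 vN] : exists2 v, f v != 0 & v \notin [:: u; (n - u)%N].
  case: (boolP [exists v : 'I_n.+1, (f v != 0) && (val v \notin [:: u; (n - u)%N])]) =>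
    [/existsP[v /andP[]]|/existsPn N].
    by exists v.
  have := sum0; rewrite (@sum_supported n [:: u; (n - u)%N] f).
  - rewrite !big_cons big_nil (opp u u0) => E; move: u0; have -> : f u = 0 by lia.
    by rewrite eqxx.
  - by rewrite /= inE andbT; lia.
  - by move=> x; rewrite !inE => /orP[] /eqP->; lia.
  - move=> x x0; have := N (Ordinal (n:=n.+1) (m:=x) (le_n x x0)).
    by rewrite /= x0 /= negbK.
have nv := layer_opp_neq0 v0; have vn := le_n v v0.
have U3 : uniq [:: v; u; (n - u)%N] by rewrite /= vN !inE; apply/andP; split => //; lia.
have three x : x = d \/ f x != 0 -> x \in [:: v; u; (n - u)%N].
  move=> hx; apply/negPn/negP => xN.
  have := @layers_bound [:: x; v; u; (n - u)%N]; rewrite lim ltnn.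
  move=> F; suff: false by []. apply: F; last by exists u; rewrite ?inE ?eqxx ?orbT.
    by rewrite cons_uniq xN.
  by move=> z; rewrite !inE => /or4P[] /eqP->; auto.
(* The layer [n - v] is nonzero too, so [n - v] is one of the three weights, and only [v] is
   possible. *)
have ve : (2 * v = n)%N.
  by have := three _ (or_intror nv); move: vN; rewrite !inE; lia.
have dE := three d (or_introl erefl).
have [du1 du2] : (d <= u)%N /\ (d <= n - u)%N by [].
have dE2 : d \in [:: u; (n - u)%N] by move: dE; rewrite !inE; lia.
have d0 : f d != 0 by move: dE2; rewrite !inE => /orP[] /eqP->.
have hv : n./2 = v by lia.
have sup x : f x != 0 -> x \in [:: d; (n - d)%N; n./2].
  by move=> x0; have := three x (or_intror x0); move: dE2; rewrite hv !inE; lia.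
have dn : (2 * d < n)%N by move: dE2; rewrite !inE; lia.
have E := sum0; rewrite (@sum_supported n [:: d; (n - d)%N; n./2] f) // in E; first last.
- by move=> x; rewrite !inE => /or3P[] /eqP->; lia.
- by rewrite /= !inE; lia.
rewrite !big_cons big_nil opp // in E.
split; rewrite ?opp //; try lia.
- by have [_ _ /andP[]] := layer_weight d0.
- by split => //; lia.
Qed.

Lemma transform_odd w : dp = t.+2 -> odd t.+1 ->
  kraw_coef (d - t.+1) (n - 2 * d) 1 w = 0 ->
  \sum_(u < n.+1) f u * (kraw n t.+1 u)`_(2 * w + 1) = 0.
Proof.
move=> dpt ot K; case: (layers_two dpt ot) => [f0|[td dn fd sup]].
  by apply: big1 => u _; rewrite f0 mul0r.
rewrite (@sum_supported n [:: d; (n - d)%N]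
  (fun u => f u * (kraw n t.+1 u)`_(2 * w + 1))).
(* Up to sign, both layers are multiplied by the coefficient that [K] makes zero. *)
- by rewrite !big_cons big_nil kraw_lower ?kraw_upper ?K ?mulr0 //; lia.
- by rewrite /= inE andbT; lia.
- by move=> x; rewrite !inE => /orP[] /eqP->; lia.
- by move=> x x0; apply: sup; apply: contra_neq x0 => ->; rewrite mul0r.
Qed.

Lemma transform_even w : dp = t.+3 -> ~~ odd t.+1 ->
  kraw_coef (d - t.+1) (n - 2 * d) 0 w + (-1) ^+ w.+1 * 'C(n./2 - t.+1, w)%:Z = 0 ->
  \sum_(u < n.+1) f u * (kraw n t.+1 u)`_(2 * w + 0) = 0.
Proof.
move=> dpt ot K; case: (layers_three dpt ot) => [f0|[td dn fd fh [nE sup]]].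
  by apply: big1 => u _; rewrite f0 mul0r.
rewrite (@sum_supported n [:: d; (n - d)%N; n./2]
  (fun u => f u * (kraw n t.+1 u)`_(2 * w + 0))).
- rewrite !big_cons big_nil kraw_upper ?(kraw_lower _ (u := d))
     ?(kraw_lower _ (u := n./2)) //; try lia.
  (* The layers [d] and [n - d] give [2 * f d] times the sum in [K], and the middle layer gives
     [-2 * f d] times its signed binomial, so the total is [2 * f d] times the left side of [K]. *)
  rewrite -nE subnn kraw_coef0 fd fh.
  set S := kraw_coef _ _ _ _ in K *; rewrite exprS in K.
  set z := 'C(_, _)%:Z in K *.
  have -> : S = S + -1 * (-1) ^+ w * z + (-1) ^+ w * z by ring.
  by rewrite K; ring.
- by rewrite /= !inE; lia.
- by move=> x; rewrite !inE => /or3P[] /eqP->; lia.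
- by move=> x x0; apply: sup; apply: contra_neq x0 => ->; rewrite mul0r.
Qed.

End Harmonic.

End TopDegree.

Theorem theorem1p2 (n : nat) (C : {vspace 'rV['F_2]_n}) (d dperp t : nat)
  (hone : const_mx (1%R : 'F_2) \in C)
  (hd : is_min_dist [set c : 'rV['F_2]_n | c \in C] d)
  (hdp : is_min_dist (dual_code C) dperp)
  (ht : (0 < t)%N)
  (hcount : (dperp - t)%N = nb_weights C t)
  (w : nat) :
  ((dperp, t) = (4, 2)%N ->
     (\sum_(0 <= i < w.+1)
        (-1) ^+ (w - i) * ('C(d - 3, w - i))%:Z * ('C(n - 2 * d, 2 * i + 1))%:Z
       = 0 :> int)%R ->
     is_design 3 (support_blocks (dual_code C) (2 * w + 4))) /\
  (((dperp, t) = (4, 1)%N \/ (dperp, t) = (6, 3)%N) ->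
     ((\sum_(0 <= i < w.+1)
         (-1) ^+ (w - i) * ('C(d - t.+1, w - i))%:Z * ('C(n - 2 * d, 2 * i))%:Z)
       + (-1) ^+ w.+1 * ('C(n./2 - t.+1, w))%:Z
       = 0 :> int)%R ->
     is_design t.+1 (support_blocks (dual_code C) (2 * w + t.+1))).
Proof.
split=> [[Ed Et] K|E K].
  (* The block size splits as an odd coefficient index plus the [t + 1 = 3] pairs. *)
  rewrite (_ : 2 * w + 4 = 2 * w + 1 + 3)%N; last by lia.
  subst dperp t; apply: (dual_design hdp _ hcount) => // ps U s3.
  exact: (transform_odd (isT : 0 < 2 < 4)%N hcount hone hd U s3).
have [td Ed ot] : [/\ (0 < t < dperp)%N, dperp = t.+3 & ~~ odd t.+1].
  by case: E => [[-> ->]|[-> ->]].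
rewrite -[(2 * w)%N]addn0; apply: (dual_design hdp _ hcount) => // ps U s3.
apply: (transform_even hdp td hcount hone hd U s3) => //; rewrite -[RHS]K; congr (_ + _).
by apply: eq_bigr => i _; rewrite addn0.
Qed.
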